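(* Let $X,Y$ be finite-dimensional real vector spaces endowed with gauges $\gamma_X,\gamma_Y$ and symplectic forms $\omega_X,\omega_Y$, respectively, and let $T:(X,\gamma_X,\omega_X)\to(Y,\gamma_Y,\omega_Y)$ be a linear isometry of gauge spaces, i.e. a linear map which is a gauge isometry from $(X,\gamma_X)$ to $(Y,\gamma_Y)$. Denote by $\gamma_{\omega_X}$ and $\gamma_{\omega_Y}$ the dual gauges of $\gamma_X$ (with respect to $\omega_X$) and of $\gamma_Y$ (with respect to $\omega_Y$). If $T$ is a symplectic linear map, i.e. $\omega_Y(Tx,Ty)=\omega_X(x,y)$ for all $x,y\in X$, then $T$ is an isometry between the respective dual gauges $\gamma_{\omega_X}$ and $\gamma_{\omega_Y}$. If $T$ is not symplectic, then the dual gauges are still isometric, but not necessarily by $T$.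
   Context: A gauge on a finite-dimensional real vector space $X$ is a function $\gamma:X\to\mathbb{R}$ with $\gamma(x)\ge 0$ and equality iff $x=0$, $\gamma(\alpha x)=\alpha\gamma(x)$ for $\alpha\ge0$, and $\gamma(x+y)\le\gamma(x)+\gamma(y)$. Its unit ball is $K=\{x:\gamma(x)\le1\}$, a convex body (compact convex set with non-empty interior) with $0$ in its interior. The induced distance is $d(x,z)=\gamma(z-x)$. A map $T$ between gauge spaces $(X,\gamma_X)$ and $(Y,\gamma_Y)$ is a gauge isometry if $d_X(x,z)=d_Y(Tx,Tz)$ for all $x,z\in X$; two gauge spaces are called isometric if there is a surjective gauge isometry between them. A symplectic form $\omega$ on an (even-dimensional) vector space $X$ is a nondegenerate skew-symmetric bilinear form. It gives an isomorphism $\mathcal{I}:X^*\to X$ determined by $f(\cdot)=\omega(\mathcal{I}(f),\cdot)$. The polar body of $K$ is $K^\circ=\{f\in X^*: f(x)\le1\ \forall x\in K\}$, the dual body is $K^\omega=\mathcal{I}(K^\circ)$ (a convex body in $X$ with $0$ in its interior), and the dual gauge $\gamma_\omega$ of $\gamma$ is the gauge with unit ball $K^\omega$, i.e. $\gamma_\omega(x)=\inf\{\lambda\ge0:x\in\lambda K^\omega\}$.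
   Formalization: The linear isometry T is additionally assumed to be surjective; without this the claim fails, e.g. for an isometric linear embedding of the Euclidean plane onto a Lagrangian plane of Euclidean 4-space, whose dual gauges are not isometric. *)

(* Defs.v *)
From HB Require Import structures.
From mathcomp Require Import all_boot all_order all_algebra.
From mathcomp Require Import sesquilinear.
From mathcomp Require Import boolp classical_sets reals.

Set Implicit Arguments.
Unset Strict Implicit.
Unset Printing Implicit Defensive.

Import Order.TTheory GRing.Theory Num.Theory.
Local Open Scope classical_set_scope.
Local Open Scope ring_scope.

Section Gauges.
Variable R : realType.

Record is_gauge (X : lmodType R) (g : X -> R) : Prop := IsGauge {
  gauge_ge0 : forall x, 0 <= g x ;
  gauge_eq0 : forall x, g x = 0 <-> x = 0 ;
  gauge_scale : forall (a : R) x, 0 <= a -> g (a *: x) = a * g x ;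
  gauge_triangle : forall x y, g (x + y) <= g x + g y }.

(* A gauge need not be even, so the order of the arguments matters. *)
Definition gauge_dist (X : lmodType R) (g : X -> R) (x z : X) : R := g (z - x).

Definition gauge_isometry (X Y : lmodType R) (gX : X -> R) (gY : Y -> R)
    (T : X -> Y) : Prop :=
  forall x z, gauge_dist gX x z = gauge_dist gY (T x) (T z).

(* The map is not required to be linear. *)
Definition isometric (X Y : lmodType R) (gX : X -> R) (gY : Y -> R) : Prop :=
  exists T : X -> Y,
    gauge_isometry gX gY T /\ (forall y, exists x, T x = y).

Definition unit_ball (X : lmodType R) (g : X -> R) : set X :=
  [set x | g x <= 1].

Definition polar (X : vectType R) (K : set X) : set 'Hom(X, R^o) :=
  [set f : 'Hom(X, R^o) | forall x, K x -> (f x : R) <= 1].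

(* I(f) is the vector z with f = w(z, .); for a nondegenerate w it exists and is
   unique, see [symp_isoE] and [symp_iso_unique] below. *)
Definition symp_iso (X : vectType R) (w : {skew_symmetric X})
    (f : 'Hom(X, R^o)) : X :=
  xget 0 [set z | forall x, f x = w z x].

Definition dual_body (X : vectType R) (w : {skew_symmetric X}) (K : set X) :
    set X :=
  symp_iso w @` polar K.

Definition dual_gauge (X : vectType R) (g : X -> R) (w : {skew_symmetric X})
    (x : X) : R :=
  inf [set l : R | 0 <= l /\
                   [set l *: k | k in dual_body w (unit_ball g)] x].

Definition symplectic_map (X Y : vectType R) (wX : {skew_symmetric X})
    (wY : {skew_symmetric Y}) (T : X -> Y) : Prop :=
  forall x y, wY (T x) (T y) = wX x y.

End Gauges.

Section SympIsoTheory.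
Variables (R : realType) (X : vectType R) (w : {skew_symmetric X}).
Hypothesis w_nondeg : nondegenerate w.

Lemma nondegenerate_inj z : (forall x, w z x = 0) -> z = 0.
Proof.
move=> wz0; apply/eqP; rewrite -memv0 -(eqP w_nondeg).
by apply/mem_orthovP => x _; rewrite wz0.
Qed.

Lemma symp_iso_unique (z z' : X) : (forall x, w z x = w z' x) -> z = z'.
Proof.
move=> e; apply/eqP; rewrite -subr_eq0; apply/eqP/nondegenerate_inj => x.
by rewrite linearBl /= e subrr.
Qed.

Let flat (z : X) : 'Hom(X, R^o) := linfun (applyr w z : X -> R^o).

Let flatE z x : flat z x = w x z.
Proof. by rewrite lfunE. Qed.

Let flat_linear : linear flat.
Proof.
by move=> a x y; apply/lfunP => u; rewrite add_lfunE scale_lfunE !flatE linearPr.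
Qed.

Lemma symp_iso_exists (f : 'Hom(X, R^o)) : exists z, forall x, f x = w z x.
Proof.
pose F : {linear X -> 'Hom(X, R^o)} :=
  HB.pack flat (GRing.isLinear.Build R X 'Hom(X, R^o) *:%R flat flat_linear).
have FE z : linfun F z = flat z by rewrite lfunE.
have ker0 : lker (linfun F) == 0%VS.
  rewrite -subv0; apply/subvP => z; rewrite memv_ker FE => /eqP e.
  rewrite memv0; apply/eqP/nondegenerate_inj => x.
  by rewrite hermC /= -flatE e zero_lfunE mulr0.
have full : limg (linfun F) = fullv.
  apply/eqP; rewrite eqEdim subvf /= limg_dim_eq; last first.
    by rewrite (eqP ker0) capv0.
  by rewrite !dimvf; change (dim X * 1 <= dim X)%N; rewrite muln1.
have fin : - f \in limg (linfun F) by rewrite full memvf.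
exists ((linfun F)^-1%VF (- f)) => x; rewrite hermC /= -flatE -FE.
by rewrite limg_lfunVK // opp_lfunE mulN1r opprK.
Qed.

Lemma symp_isoE (f : 'Hom(X, R^o)) x : f x = w (symp_iso w f) x.
Proof.
have [z zP] := symp_iso_exists f.
by rewrite /symp_iso; case: xgetP => [y _ /(_ x) //|/(_ z)]; case.
Qed.

End SympIsoTheory.

(* Main.v *)
(** For a nondegenerate form [w], unwinding the polar body gives
    [dual_gauge g w x = inf {l >= 0 | w x y <= l * g y for all y}].
    Hence any map [S] with [wY (S z) (T x) = wX z x] carries the dual gauge of
    [gX] to the dual gauge of [gY].  Such an [S] always exists, namely the
    adjoint of [T^-1], and it is [T] itself exactly when [T] is symplectic.
    Doubling the area form of the plane doubles the dual gauge, so the identity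
    is an isometry of the l1 norm but not of the dual gauges. *)
Require Import Defs.
From HB Require Import structures.
From mathcomp Require Import all_boot all_order all_algebra.
From mathcomp Require Import sesquilinear.
From mathcomp Require Import boolp classical_sets reals.
From mathcomp Require Import ring.

Set Implicit Arguments.
Unset Strict Implicit.
Unset Printing Implicit Defensive.

Import Order.TTheory GRing.Theory Num.Theory.
Local Open Scope classical_set_scope.
Local Open Scope ring_scope.

Section DualGauge.
Variables (R : realType) (X : vectType R) (g : X -> R).
Variable w : {skew_symmetric X}.
Hypotheses (g_gauge : is_gauge g) (w_nondeg : nondegenerate w).

Lemma dual_bodyP (K : set X) z :
  dual_body w K z <-> forall x, K x -> w z x <= 1.
Proof.
split=> [[f Kf <-] x Kx|zK]; first by rewrite -symp_isoE //; exact: Kf.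
(* [applyr w z] is the functional [w _ z]; by skew symmetry its negative is [w z _], which
   [symp_iso w] sends back to [z]. *)
pose f : 'Hom(X, R^o) := - linfun (applyr w z : X -> R^o).
have fE x : f x = w z x.
  by rewrite opp_lfunE lfunE /= hermC /= expr1 mulN1r opprK.
exists f => [x Kx|]; first by rewrite fE zK.
by apply: (symp_iso_unique w_nondeg) => x; rewrite -symp_isoE.
Qed.

Lemma dual_gaugeE x :
  dual_gauge g w x = inf [set l | 0 <= l /\ forall y, w x y <= l * g y].
Proof.
congr inf; apply/seteqP; split=> l /= [l0].
  case=> k /dual_bodyP kK <-; split=> // y.
  rewrite linearZl_LR /=; apply: ler_wpM2l => //.
  (* Homogeneity carries the bound from the unit ball to every [y]: a nonzero [y] is first scaled to
     gauge 1. *)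
  have [y0|y0] := eqVneq y 0.
    by rewrite y0 linear0r (gauge_eq0 g_gauge 0).2.
  have gy : 0 < g y.
    rewrite lt0r (gauge_ge0 g_gauge) andbT.
    by apply: contra_neq y0 => /(gauge_eq0 g_gauge).
  have gV : 0 <= (g y)^-1 by rewrite invr_ge0 ltW.
  have := kK ((g y)^-1 *: y); rewrite /unit_ball /= (gauge_scale g_gauge) //.
  rewrite mulVf ?gt_eqF // lexx => /(_ isT).
  by rewrite linearZr_LR /= mulrC ler_pdivrMr // mul1r.
move=> xl; split=> //; have [l_eq0|l_neq0] := eqVneq l 0.
  exists 0; first by apply/dual_bodyP => y _; rewrite linear0l.
  (* The factor 0 reaches only the origin, so [x] must vanish: the bounds at [y] and at [- y] force
     [w x y = 0]. *)
  rewrite l_eq0 scale0r; apply/esym/(nondegenerate_inj w_nondeg) => y.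
  have := xl y; have := xl (- y).
  rewrite l_eq0 !mul0r linearNr oppr_le0 => ge0 le0.
  by apply/eqP; rewrite eq_le le0.
have l_gt0 : 0 < l by rewrite lt0r l_neq0.
exists (l^-1 *: x); last by rewrite scalerA divff // scale1r.
apply/dual_bodyP => y gy1; rewrite linearZl_LR /= mulrC ler_pdivrMr // mul1r.
by apply: (le_trans (xl y)); rewrite ler_piMr.
Qed.

Lemma dual_gauge_eq x m : 0 <= m -> (forall y, w x y <= m * g y) ->
  (forall l, (forall y, w x y <= l * g y) -> m <= l) -> dual_gauge g w x = m.
Proof.
move=> m0 xm m_min; rewrite dual_gaugeE.
apply/eqP; rewrite eq_le; apply/andP; split.
  by apply: ge_inf => //; exists 0 => l [].
by apply: lb_le_inf; [exists m|move=> l [_ /m_min]].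
Qed.

End DualGauge.

(** [S y] is the vector representing the functional [x |-> wY y (A x)] through [wX]. *)
Lemma symp_adjoint_exists (R : realType) (X Y : vectType R)
    (wX : {skew_symmetric X}) (wY : {skew_symmetric Y}) (A : 'Hom(X, Y)) :
  nondegenerate wX -> exists S : Y -> X, forall y x, wX (S y) x = wY y (A x).
Proof.
move=> wX_nondeg.
pose f y : 'Hom(X, R^o) := - (linfun (applyr wY y : Y -> R^o) \o A)%VF.
exists (fun y => symp_iso wX (f y)) => y x.
by rewrite -symp_isoE // opp_lfunE comp_lfunE lfunE /= hermC /= expr1 mulN1r opprK.
Qed.

Section Isometry.
Variables (R : realType) (X Y : vectType R) (gX : X -> R) (gY : Y -> R).
Variables (wX : {skew_symmetric X}) (wY : {skew_symmetric Y}).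
Variable T : {linear X -> Y}.
Hypotheses (gX_gauge : is_gauge gX) (gY_gauge : is_gauge gY).
Hypotheses (wX_nondeg : nondegenerate wX) (wY_nondeg : nondegenerate wY).
Hypothesis T_isometry : gauge_isometry gX gY T.
Hypothesis T_surj : forall y, exists x, T x = y.

Lemma linear_gauge_isometryE x : gY (T x) = gX x.
Proof. by have := T_isometry 0 x; rewrite /gauge_dist -linearB subr0 => ->. Qed.

Section Adjoint.
Variable S : X -> Y.
Hypothesis ST : forall z x, wY (S z) (T x) = wX z x.

(** Since [T] is onto, every test vector of [Y] is some [T x], so both gauges are infima of the same
    set of factors. *)
Lemma dual_gauge_adjoint z : dual_gauge gY wY (S z) = dual_gauge gX wX z.
Proof.
rewrite !dual_gaugeE //; congr inf.
apply/seteqP; split=> l /= [l0 zl]; split=> // y.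
  by rewrite -ST -linear_gauge_isometryE.
by have [x <-] := T_surj y; rewrite ST linear_gauge_isometryE.
Qed.

(** [S] is not assumed linear; pairing with the vectors [T u], which fill [Y], shows that it
    respects differences. *)
Lemma adjoint_isometry :
  gauge_isometry (dual_gauge gX wX) (dual_gauge gY wY) S.
Proof.
move=> x z; rewrite /gauge_dist -dual_gauge_adjoint; congr dual_gauge.
apply: (symp_iso_unique wY_nondeg) => y; have [u <-] := T_surj y.
by rewrite linearBl /= !ST linearBl.
Qed.

End Adjoint.

Lemma dual_gauge_isometric : isometric (dual_gauge gX wX) (dual_gauge gY wY).
Proof.
(* A kernel vector of [T] has gauge 0, so [T] is injective and [(linfun T)^-1] is a left inverse. *)
have T_ker : lker (linfun T) == 0%VS.
  rewrite -subv0; apply/subvP => x; rewrite memv_ker lfunE /= memv0 => /eqP Tx0.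
  apply/eqP/(gauge_eq0 gX_gauge).
  by rewrite -linear_gauge_isometryE Tx0; apply/(gauge_eq0 gY_gauge).
(* [S] is the adjoint of the inverse of [T], and [U] that of [T]. Then [S (U y)] pairs with each
   [T x] as [y] does, so [S (U y) = y] and [S] is onto. *)
have [S SE] := symp_adjoint_exists wX (linfun T)^-1%VF wY_nondeg.
have [U UE] := symp_adjoint_exists wY (linfun T) wX_nondeg.
have ST z x : wY (S z) (T x) = wX z x.
  by rewrite SE -[T x](lfunE T) lker0_lfunK.
exists S; split; first exact: adjoint_isometry.
move=> y; exists (U y); apply: (symp_iso_unique wY_nondeg) => y'.
by have [x <-] := T_surj y'; rewrite ST UE lfunE.
Qed.

End Isometry.

Section Plane.
Variable R : realType.
Local Notation plane := 'rV[R]_2.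

Lemma row2_eq0 (u : plane) : u 0 0 = 0 -> u 0 1 = 0 -> u = 0.
Proof.
move=> u0 u1; apply/rowP; case=> [[|[|//]] i_lt]; rewrite mxE /=.
  by rewrite -u0; congr (u _ _); apply/val_inj.
by rewrite -u1; congr (u _ _); apply/val_inj.
Qed.

Definition l1_norm (u : plane) : R := `|u 0 0| + `|u 0 1|.

Lemma l1_norm_gauge : is_gauge l1_norm.
Proof.
split=> [u|u|a u a0|u v]; rewrite /l1_norm.
- by rewrite addr_ge0.
- split=> [/eqP|->]; last by rewrite !mxE normr0 addr0.
  by rewrite paddr_eq0 // !normr_eq0 => /andP[/eqP u0 /eqP /(row2_eq0 u0)].
- by rewrite !mxE !normrM ger0_norm // mulrDr.
- by rewrite !mxE addrACA lerD // ler_normD.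
Qed.

(** The determinant scaled by [c], so that one plane carries several symplectic forms. *)
Definition area (c : R) (u v : plane) : R :=
  c * (u 0 0 * v 0 1 - u 0 1 * v 0 0).

Lemma area_bilinear c : bilinear_for
  (GRing.Scale.Law.clone _ _ *%R _) (GRing.Scale.Law.clone _ _ (idfun \; *%R) _)
  (area c).
Proof. by split=> [v|u] a x y; rewrite /area !mxE /=; ring. Qed.

HB.instance Definition _ c := bilinear_isBilinear.Build R plane plane R
  (GRing.Scale.Law.clone _ _ *%R _) (GRing.Scale.Law.clone _ _ (idfun \; *%R) _)
  (area c) (area_bilinear c).

Lemma area_skew c u v : area c u v = (-1) ^+ true * idfun (area c v u).
Proof. by rewrite /area /=; ring. Qed.

HB.instance Definition _ c :=
  isHermitianSesquilinear.Build R plane true idfun (area c) (area_skew c).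

Lemma area_e0l c u : area c 'e_0 u = c * u 0 1.
Proof. by rewrite /area !mxE /=; ring. Qed.

Lemma area_e1l c u : area c 'e_1 u = - (c * u 0 0).
Proof. by rewrite /area !mxE /=; ring. Qed.

Lemma area_psymplectic c :
  c != 0 -> is_psymplectic (area c : {skew_symmetric plane}).
Proof.
move=> c0; split=> [|//|_ u]; last by rewrite /= /area; ring.
rewrite /nondegenerate -subv0; apply/subvP => u /mem_orthovP u_rad.
have u_rad' v : area c v u = 0 by rewrite area_skew u_rad ?memvf // mulr0.
(* Pairing with ['e_1] and ['e_0] reads off the coordinates of [u] up to the factors [- c] and
   [c]. *)
rewrite memv0; apply/eqP/row2_eq0; apply: (mulfI c0); rewrite mulr0.
  by apply: oppr_inj; rewrite oppr0 -area_e1l u_rad'.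
by rewrite -area_e0l u_rad'.
Qed.

(** The pairing of ['e_0] with [y] is [c * y 0 1], at most [c] times the l1 norm of [y], with
    equality at ['e_1]. *)
Lemma dual_l1_norm_area c :
  0 < c -> dual_gauge l1_norm (area c : {skew_symmetric plane}) 'e_0 = c.
Proof.
move=> c0; have [area_nondeg _ _] := area_psymplectic (lt0r_neq0 c0).
apply: (dual_gauge_eq l1_norm_gauge area_nondeg) => [|y|l /(_ 'e_1)].
- exact: ltW.
- by rewrite [X in X <= _]area_e0l ler_pM2l // (le_trans (ler_norm _)) // lerDr.
- by rewrite [X in X <= _]area_e0l /l1_norm !mxE /= normr0 normr1 add0r !mulr1.
Qed.

End Plane.

Theorem theorem3p1 (R : realType) :
  (forall (X Y : vectType R) (gX : X -> R) (gY : Y -> R)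
      (wX : {skew_symmetric X}) (wY : {skew_symmetric Y}) (T : {linear X -> Y}),
    is_gauge gX -> is_gauge gY ->
    is_psymplectic wX -> is_psymplectic wY ->
    gauge_isometry gX gY T -> (forall y, exists x, T x = y) ->
    (symplectic_map wX wY T ->
       gauge_isometry (dual_gauge gX wX) (dual_gauge gY wY) T) /\
    (~ symplectic_map wX wY T ->
       isometric (dual_gauge gX wX) (dual_gauge gY wY))) /\
  (exists (X Y : vectType R) (gX : X -> R) (gY : Y -> R)
      (wX : {skew_symmetric X}) (wY : {skew_symmetric Y}) (T : {linear X -> Y}),
    is_gauge gX /\ is_gauge gY /\
    is_psymplectic wX /\ is_psymplectic wY /\
    gauge_isometry gX gY T /\ (forall y, exists x, T x = y) /\
    ~ symplectic_map wX wY T /\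
    ~ gauge_isometry (dual_gauge gX wX) (dual_gauge gY wY) T).
Proof.
split=> [X Y gX gY wX wY T gX_gauge gY_gauge [wX_nondeg _ _] [wY_nondeg _ _]|].
  move=> T_isometry T_surj.
  (* For symplectic [T], the choice [S := T] satisfies the adjoint relation. *)
  by split=> [|_]; [exact: adjoint_isometry|exact: dual_gauge_isometric].
pose plane : vectType R := 'rV[R]_2.
have area1 := area_psymplectic (oner_neq0 R).
have two_neq0 : 2 != 0 :> R by rewrite pnatr_eq0.
have area2 := area_psymplectic two_neq0.
exists plane, plane, (@l1_norm R), (@l1_norm R), (area 1), (area 2), idfun.
do 4![split; first by [exact: l1_norm_gauge|]].
split; first by []; split; first by move=> y; exists y.
(* On ['e_0], ['e_1] the forms take the values 1 and 2; the dual distances from 0 to ['e_0] are also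
   1 and 2. *)
split=> [/(_ 'e_0 'e_1)|/(_ 0 'e_0)].
  rewrite /= !area_e0l !mxE !mulr1 => /eqP.
  by rewrite (eqr_nat R 2 1).
rewrite /gauge_dist /= !subr0 !dual_l1_norm_area // => /eqP.
by rewrite (eqr_nat R 1 2).
Qed.
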